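(* There is an infinite $\Pi_1$ set (a subset of $\mathbb{N}$) with no $\Delta_2$ p-cohesive subset.
   Context: $\Pi_1$ and $\Delta_2$ refer to the arithmetical hierarchy of subsets of $\mathbb{N}$. For $X, Y \subseteq \mathbb{N}$, $X \subseteq^* Y$ means that $X \setminus Y$ is finite. A set $C \subseteq \mathbb{N}$ is p-cohesive if it is infinite and for every primitive recursive set $A \subseteq \mathbb{N}$, either $C \subseteq^* A$ or $C \subseteq^* \mathbb{N} \setminus A$. *)

(* Defs.v *)
From mathcomp Require Import all_boot.
From mathcomp Require Import boolp classical_sets cardinality.

Set Implicit Arguments.
Unset Strict Implicit.
Unset Printing Implicit Defensive.

Local Open Scope classical_set_scope.

Definition fcomp n m (f : m.-tuple nat -> nat)
    (g : 'I_m -> n.-tuple nat -> nat) (v : n.-tuple nat) : nat :=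
  f [tuple g i v | i < m].

(** [fprec f g (0, w) = f w] and
    [fprec f g (k + 1, w) = g (k, fprec f g (k, w), w)]. *)
Definition fprec n (f : n.-tuple nat -> nat) (g : n.+2.-tuple nat -> nat)
    (v : n.+1.-tuple nat) : nat :=
  let w := [tuple of behead v] in
  iteri (thead v) (fun k r => g [tuple of [:: k, r & w]]) (f w).

Inductive primitive_recursive : forall n, (n.-tuple nat -> nat) -> Prop :=
| pr_zero n : primitive_recursive (fun _ : n.-tuple nat => 0)
| pr_succ : primitive_recursive (fun v : 1.-tuple nat => (thead v).+1)
| pr_proj n (i : 'I_n) : primitive_recursive (fun v : n.-tuple nat => tnth v i)
| pr_comp n m (f : m.-tuple nat -> nat) (g : 'I_m -> n.-tuple nat -> nat) :
    primitive_recursive f -> (forall i, primitive_recursive (g i)) ->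
    primitive_recursive (fcomp f g)
| pr_prec n (f : n.-tuple nat -> nat) (g : n.+2.-tuple nat -> nat) :
    primitive_recursive f -> primitive_recursive g ->
    primitive_recursive (fprec f g).

(** The total recursive functions: minimization is applied only to functions
    [f] such that every [v] admits a [y] with [f (y, v) = 0]; the premise on
    [h] of [rec_mu] says that [h v] is the least such [y]. *)
Inductive recursive : forall n, (n.-tuple nat -> nat) -> Prop :=
| rec_zero n : recursive (fun _ : n.-tuple nat => 0)
| rec_succ : recursive (fun v : 1.-tuple nat => (thead v).+1)
| rec_proj n (i : 'I_n) : recursive (fun v : n.-tuple nat => tnth v i)
| rec_comp n m (f : m.-tuple nat -> nat) (g : 'I_m -> n.-tuple nat -> nat) :
    recursive f -> (forall i, recursive (g i)) -> recursive (fcomp f g)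
| rec_prec n (f : n.-tuple nat -> nat) (g : n.+2.-tuple nat -> nat) :
    recursive f -> recursive g -> recursive (fprec f g)
| rec_mu n (f : n.+1.-tuple nat -> nat) (h : n.-tuple nat -> nat) :
    recursive f ->
    (forall v, f [tuple of h v :: v] = 0 /\
               forall y, y < h v -> f [tuple of y :: v] <> 0) ->
    recursive h.

Definition charfun n (R : set (n.-tuple nat)) (v : n.-tuple nat) : nat :=
  nat_of_bool (v \in R).

(** [k]-ary relations of the form
    [exists y1, forall y2, ... Q yn, S (yn, ..., y1, v)]
    (resp. [forall y1, exists y2, ...]) with [S] recursive. *)
Fixpoint Sigma_rel (n k : nat) (R : set (k.-tuple nat)) {struct n} : Prop :=
  match n with
  | 0 => recursive (charfun R)
  | n'.+1 => exists2 S : set (k.+1.-tuple nat), Pi_rel n' S &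
               R = [set v : k.-tuple nat | exists y : nat, S [tuple of y :: v]]
  end
with Pi_rel (n k : nat) (R : set (k.-tuple nat)) {struct n} : Prop :=
  match n with
  | 0 => recursive (charfun R)
  | n'.+1 => exists2 S : set (k.+1.-tuple nat), Sigma_rel n' S &
               R = [set v : k.-tuple nat | forall y : nat, S [tuple of y :: v]]
  end.

Definition unary (A : set nat) : set (1.-tuple nat) := [set v | A (thead v)].

Definition primitive_recursive_set (A : set nat) : Prop :=
  primitive_recursive (charfun (unary A)).

Definition Sigma_set (n : nat) (A : set nat) : Prop := Sigma_rel n (unary A).

Definition Pi_set (n : nat) (A : set nat) : Prop := Pi_rel n (unary A).

Definition Delta_set (n : nat) (A : set nat) : Prop :=
  Sigma_set n A /\ Pi_set n A.

Definition almost_subset (X Y : set nat) : Prop := finite_set (X `\` Y).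

Definition p_cohesive (C : set nat) : Prop :=
  infinite_set C /\
  forall A : set nat, primitive_recursive_set A ->
    almost_subset C A \/ almost_subset C (~` A).

(* Main.v *)
Require Import Defs.
From mathcomp Require Import all_boot.
From mathcomp Require Import boolp classical_sets cardinality.
From mathcomp Require Import zify.

Set Implicit Arguments.
Unset Strict Implicit.
Unset Printing Implicit Defensive.

Local Open Scope classical_set_scope.

(** A p-cohesive set [C] converges: for each [e], almost all elements of [C]
    agree on their [e]-th color, a primitive recursive bit.  The Pi_1 set is
    built so that the limit colors of its subsets are never Delta_3.

    Let [C_e] be the [e]-th Sigma_2 set.  The limit color [i] is admissible at
    [e] if every [x0] in [C_e] has some [x >= x0] in [C_e] of [e]-th color
    different from [i].  Some color is always admissible: otherwise, of two
    elements of [C_e] witnessing the failures, the larger one would have both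
    colors.  But if [C_e] is infinite and almost all of its elements have color
    [i] at [e], then [i] is not admissible at [e].

    Admissibility is Pi_3.  Elements of the set are codes [<n, rho, w, s>] of
    color [rho], such that [w] is the least bound on witnesses for the
    instances below [n] of the admissibility of [rho], and [s] is the first
    stage refuting the bound [w - 1].  This is a Pi_1 condition.  It determines
    [w] and [s] from [n] and [rho], so an infinite subset has elements of
    unbounded length [n], and its limit colors are admissible at every [e]. *)

(** * Primitive recursive functions and their closure properties *)

Lemma primitive_recursive_recursive n (f : n.-tuple nat -> nat) :
  primitive_recursive f -> recursive f.
Proof.
elim=> {n f} [n||n i|n m f g _ Hf _ Hg|n f g _ Hf _ Hg].
- exact: rec_zero.
- exact: rec_succ.
- exact: rec_proj.
- exact: rec_comp.
- exact: rec_prec.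
Qed.

(** Working with functions on lists avoids dependent tuple types; the values of [F] on lists of
    length other than [n] are irrelevant. *)
Definition prim n (F : seq nat -> nat) : Prop :=
  primitive_recursive (fun v : n.-tuple nat => F v).

Lemma eq_prim n (F G : seq nat -> nat) :
  (forall v, size v = n -> F v = G v) -> prim n F -> prim n G.
Proof.
rewrite /prim => FG; congr (primitive_recursive _).
by apply/funext => v; rewrite FG ?size_tuple.
Qed.

Lemma prim_comp n m f (g : seq (seq nat -> nat)) :
  prim m f -> size g = m ->
  (forall i, i < m -> prim n (nth (fun _ => 0) g i)) ->
  prim n (fun v => f [seq h v | h <- g]).
Proof.
move=> Hf Hs Hg.
have := pr_comp (g := fun i : 'I_m => fun v : n.-tuple nat => nth (fun _ => 0) g i v)
  Hf (fun i => Hg i (ltn_ord i)).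
congr (primitive_recursive _); apply/funext => v; rewrite /fcomp; congr f.
apply: (@eq_from_nth _ 0) => [|i]; rewrite size_tuple ?size_map // => Hi.
by rewrite -[i]/(val (Ordinal Hi)) -tnth_nth tnth_mktuple (nth_map (fun _ => 0)) ?Hs.
Qed.

(* [dropping k T] lets the variables of an environment extended by the bound
   variables of iterations be recognized syntactically. *)
Definition dropping k (T : seq nat -> seq nat) := forall v, T v = drop k v.

Lemma dropping0 : dropping 0 (fun v => v).
Proof. by move=> v; rewrite drop0. Qed.

Lemma droppingS k T : dropping k T -> dropping k.+1 (fun v => behead (T v)).
Proof. by move=> H v; rewrite H -drop1 drop_drop. Qed.

Lemma prim_nth n k T i :
  dropping k T -> k + i < n -> prim n (fun v => nth 0 (T v) i).
Proof.
move=> HT Hi; have := pr_proj (Ordinal Hi); congr (primitive_recursive _).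
by apply/funext => v; rewrite HT nth_drop (tnth_nth 0).
Qed.

Lemma prim_comp1 f : prim 1 (fun v => f (nth 0 v 0)) ->
  forall n F, prim n F -> prim n (fun v => f (F v)).
Proof.
by move=> Hf n F HF; apply: (prim_comp (g := [:: F]) Hf) => // -[].
Qed.

Lemma prim_comp2 f : prim 2 (fun v => f (nth 0 v 0) (nth 0 v 1)) ->
  forall n F G, prim n F -> prim n G -> prim n (fun v => f (F v) (G v)).
Proof.
move=> Hf n F G HF HG.
by apply: (prim_comp (g := [:: F; G]) Hf) => // -[|[]].
Qed.

Lemma prim_comp4 f :
  prim 4 (fun v => f (nth 0 v 0) (nth 0 v 1) (nth 0 v 2) (nth 0 v 3)) ->
  forall n F G H K, prim n F -> prim n G -> prim n H -> prim n K ->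
  prim n (fun v => f (F v) (G v) (H v) (K v)).
Proof.
move=> Hf n F G H K HF HG HH HK.
by apply: (prim_comp (g := [:: F; G; H; K]) Hf) => // -[|[|[|[]]]].
Qed.

Lemma prim_succ n F : prim n F -> prim n (fun v => (F v).+1).
Proof.
apply: (prim_comp1 (f := S)); have := pr_succ.
congr (primitive_recursive _); apply/funext => v.
by rewrite /thead (tnth_nth 0).
Qed.

Lemma prim_const n c : prim n (fun _ => c).
Proof. by elim: c => [|c IH]; [exact: pr_zero | exact: prim_succ]. Qed.

(** [fprec] recurses on its first variable, so the number of iterations is made an extra leading
    variable of [I]; composition with [N] and the projections then removes it. *)
Lemma prim_iteri n N F (H : nat -> nat -> seq nat -> nat) :
  prim n N -> prim n F ->
  prim n.+2 (fun w => H (nth 0 w 0) (nth 0 w 1) (behead (behead w))) ->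
  prim n (fun v => iteri (N v) (fun k r => H k r v) (F v)).
Proof.
move=> HN HF HH.
pose I w := iteri (nth 0 w 0) (fun k r => H k r (behead w)) (F (behead w)).
have HI : prim n.+1 I.
  have := pr_prec HF HH; congr (primitive_recursive _); apply/funext => v.
  by rewrite /fprec /I /thead (tnth_nth 0) /=.
pose g := N :: [seq (fun v : seq nat => nth 0 v i) | i <- iota 0 n].
apply: eq_prim (prim_comp (n := n) (g := g) HI _ _).
- move=> v Hv; rewrite /I /=.
  have -> // : [seq h v | h <- [seq (fun v : seq nat => nth 0 v i) | i <- iota 0 n]] = v.
  by rewrite -map_comp -[RHS](mkseq_nth 0) Hv.
- by rewrite /= size_map size_iota.
- case=> [|i] //= Hi; rewrite (nth_map 0) ?size_iota // nth_iota //.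
  exact: (prim_nth dropping0).
Qed.

Ltac prim_var :=
  match goal with
  | |- prim _ (fun v => nth 0 _ _) =>
      eapply prim_nth; [repeat (first [apply dropping0 | apply droppingS]) | done]
  end.
Ltac prim0 := first [assumption | prim_var | apply prim_const | apply prim_succ].

Lemma prim_add n F G : prim n F -> prim n G -> prim n (fun v => F v + G v).
Proof.
apply: (prim_comp2 (f := addn)).
apply: (@eq_prim _ (fun v => iteri (nth 0 v 0) (fun _ r => r.+1) (nth 0 v 1))).
  by move=> v _; elim: (nth 0 v 0) => //= k ->.
by apply: (prim_iteri (H := fun _ r _ => r.+1)); repeat prim0.
Qed.

Lemma prim_mul n F G : prim n F -> prim n G -> prim n (fun v => F v * G v).
Proof.
apply: (prim_comp2 (f := muln)).
apply: (@eq_prim _ (fun v => iteri (nth 0 v 0) (fun _ r => nth 0 v 1 + r) 0)).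
  by move=> v _; elim: (nth 0 v 0) => //= k ->.
apply: (prim_iteri (H := fun _ r v => nth 0 v 1 + r)); try prim0.
by apply: prim_add; prim0.
Qed.

Lemma prim_exp n F G : prim n F -> prim n G -> prim n (fun v => F v ^ G v).
Proof.
apply: (prim_comp2 (f := expn)).
apply: (@eq_prim _ (fun v => iteri (nth 0 v 1) (fun _ r => nth 0 v 0 * r) 1)).
  by move=> v _; elim: (nth 0 v 1) => //= k ->; rewrite expnS.
apply: (prim_iteri (H := fun _ r v => nth 0 v 0 * r)); try prim0.
by apply: prim_mul; prim0.
Qed.

Lemma prim_pred n F : prim n F -> prim n (fun v => (F v).-1).
Proof.
apply: (prim_comp1 (f := predn)).
apply: (@eq_prim _ (fun v => iteri (nth 0 v 0) (fun k _ => k) 0)).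
  by move=> v _; case: (nth 0 v 0).
by apply: (prim_iteri (H := fun k _ _ => k)); prim0.
Qed.

Lemma prim_sub n F G : prim n F -> prim n G -> prim n (fun v => F v - G v).
Proof.
apply: (prim_comp2 (f := subn)).
apply: (@eq_prim _ (fun v => iteri (nth 0 v 1) (fun _ r => r.-1) (nth 0 v 0))).
  by move=> v _; elim: (nth 0 v 1) => /= [|k ->]; rewrite ?subn0 ?subnS.
by apply: (prim_iteri (H := fun _ r _ => r.-1)); try apply: prim_pred; prim0.
Qed.

Lemma prim_negb n (b : seq nat -> bool) :
  prim n (fun v => b v) -> prim n (fun v => ~~ b v).
Proof.
move=> Hb; apply: (@eq_prim _ (fun v => 1 - b v)); first by move=> v _; case: (b v).
by apply: prim_sub; prim0.
Qed.

Lemma prim_andb n (b c : seq nat -> bool) :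
  prim n (fun v => b v) -> prim n (fun v => c v) -> prim n (fun v => b v && c v).
Proof.
move=> Hb Hc; apply: (@eq_prim _ (fun v => b v * c v)).
  by move=> v _; case: (b v); case: (c v).
exact: prim_mul.
Qed.

Lemma prim_orb n (b c : seq nat -> bool) :
  prim n (fun v => b v) -> prim n (fun v => c v) -> prim n (fun v => b v || c v).
Proof.
move=> Hb Hc; apply: (@eq_prim _ (fun v => ~~ (~~ b v && ~~ c v))).
  by move=> v _; case: (b v); case: (c v).
by do ![apply: prim_negb | apply: prim_andb | prim0].
Qed.

Lemma prim_implb n (b c : seq nat -> bool) :
  prim n (fun v => b v) -> prim n (fun v => c v) -> prim n (fun v => b v ==> c v).
Proof.
move=> Hb Hc; apply: (@eq_prim _ (fun v => ~~ b v || c v)).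
  by move=> v _; rewrite implybE.
by apply: prim_orb => //; apply: prim_negb.
Qed.

Lemma prim_leq n F G : prim n F -> prim n G -> prim n (fun v => F v <= G v).
Proof.
move=> HF HG; apply: (@eq_prim _ (fun v => 1 - (F v - G v))).
  by move=> v _; rewrite /leq; case: (F v - G v).
by do ![apply: prim_sub | prim0].
Qed.

Lemma prim_eq n F G : prim n F -> prim n G -> prim n (fun v => F v == G v).
Proof.
move=> HF HG; apply: (@eq_prim _ (fun v => (F v <= G v) && (G v <= F v))).
  by move=> v _; rewrite eqn_leq.
by do ![apply: prim_andb | apply: prim_leq | prim0].
Qed.

Lemma prim_if n (b : seq nat -> bool) F G :
  prim n (fun v => b v) -> prim n F -> prim n G ->
  prim n (fun v => if b v then F v else G v).
Proof.
move=> Hb HF HG; apply: (@eq_prim _ (fun v => b v * F v + ~~ b v * G v)).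
  by move=> v _; case: (b v); rewrite /= ?mul1n ?mul0n ?addn0.
by do ![apply: prim_add | apply: prim_mul | apply: prim_negb | prim0].
Qed.

Definition ball N (p : nat -> bool) := all p (iota 0 N).
Definition bex N (p : nat -> bool) := has p (iota 0 N).

Lemma ballP N (p : nat -> bool) : reflect (forall k, k < N -> p k) (ball N p).
Proof.
by apply: (iffP allP) => H k; [have := H k; rewrite mem_iota | rewrite mem_iota => /H].
Qed.

Lemma bexP N (p : nat -> bool) : reflect (exists2 k, k < N & p k) (bex N p).
Proof.
by apply: (iffP hasP) => -[k Hk pk]; exists k => //; move: Hk; rewrite mem_iota.
Qed.

Lemma prim_ball n N (p : nat -> seq nat -> bool) :
  prim n N -> prim n.+1 (fun w => p (nth 0 w 0) (behead w)) ->
  prim n (fun v => ball (N v) (fun k => p k v)).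
Proof.
move=> HN Hp.
apply: (@eq_prim _ (fun v => iteri (N v) (fun k r => r * p k v) 1)).
  move=> v _; rewrite /ball; elim: (N v) => // k IH.
  by rewrite iteriS IH -addn1 iotaD all_cat /= andbT; case: (all _ _); case: (p k v).
apply: (prim_iteri (H := fun k r v => r * p k v)) => //; first prim0.
apply: prim_mul; first prim0.
(* The body [p] does not see the accumulator, so position 1 of the environment is skipped. *)
pose g := (fun v : seq nat => nth 0 v 0) ::
  [seq (fun v : seq nat => nth 0 v i.+2) | i <- iota 0 n].
apply: eq_prim (prim_comp (n := n.+2) (g := g) Hp _ _).
- case=> [|k [|r v]] // [Hv] /=.
  have -> // : [seq h [:: k, r & v] |
      h <- [seq (fun v : seq nat => nth 0 v i.+2) | i <- iota 0 n]] = v.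
  by rewrite -map_comp -[RHS](mkseq_nth 0) Hv.
- by rewrite /= size_map size_iota.
- case=> [|i] //= Hi; first exact: (prim_nth dropping0).
  rewrite (nth_map 0) ?size_iota // nth_iota //.
  exact: (prim_nth dropping0).
Qed.

Lemma prim_bex n N (p : nat -> seq nat -> bool) :
  prim n N -> prim n.+1 (fun w => p (nth 0 w 0) (behead w)) ->
  prim n (fun v => bex (N v) (fun k => p k v)).
Proof.
move=> HN Hp; apply: (@eq_prim _ (fun v => ~~ ball (N v) (fun k => ~~ p k v))).
  by move=> v _; rewrite /ball /bex all_predC negbK.
by apply: prim_negb; apply: prim_ball => //; apply: prim_negb.
Qed.

Lemma prim_odd n F : prim n F -> prim n (fun v => odd (F v)).
Proof.
apply: (prim_comp1 (f := fun k => odd k : nat)).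
apply: (@eq_prim _ (fun v => iteri (nth 0 v 0) (fun _ r => 1 - r) 0)).
  by move=> v _; elim: (nth 0 v 0) => //= k ->; case: (odd k).
by apply: (prim_iteri (H := fun _ r _ => 1 - r)); try apply: prim_sub; prim0.
Qed.

Lemma prim_half n F : prim n F -> prim n (fun v => (F v)./2).
Proof.
apply: (prim_comp1 (f := half)).
(* The halves of [k] and [k.+1] add up to [k]. *)
apply: (@eq_prim _ (fun v => iteri (nth 0 v 0) (fun k r => k - r) 0)).
  by move=> v _; elim: (nth 0 v 0) => // k; rewrite iteriS => ->; lia.
by apply: (prim_iteri (H := fun k r _ => k - r)); try apply: prim_sub; prim0.
Qed.

(** * Binary codes of finite sets, and codes of pairs *)

Definition bit s i := odd (iter i half s).

Lemma prim_bit n F G : prim n F -> prim n G -> prim n (fun v => bit (F v) (G v)).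
Proof.
apply: (prim_comp2 (f := fun s i => bit s i : nat)); apply: prim_odd.
apply: (@eq_prim _ (fun v => iteri (nth 0 v 1) (fun _ r => r./2) (nth 0 v 0))).
  by move=> v _; elim: (nth 0 v 1) => //= k ->.
by apply: (prim_iteri (H := fun _ r _ => r./2)); try apply: prim_half; prim0.
Qed.

(** A number read as a finite set exceeds all its elements, so it bounds every search through
    them. *)
Lemma bit_lt s i : bit s i -> i < s.
Proof.
rewrite /bit; elim: i s => [|i IH] s; first by case: s.
by rewrite iterSr => /IH; lia.
Qed.

Lemma bit_exists (X : nat -> bool) n :
  exists2 s, s < 2 ^ n & forall i, bit s i = (i < n) && X i.
Proof.
elim: n X => [|n IH] X.
  by exists 0 => // i; apply/negbTE/negP => /bit_lt.
have [s Hs HX] := IH (fun i => X i.+1).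
exists (X 0 + s.*2); first by rewrite expnS; case: (X 0) => /=; lia.
case=> [|i]; first by rewrite /bit /= oddD odd_double addbF; case: (X 0).
rewrite /bit iterSr half_bit_double -/(bit s i) HX //.
Qed.

(** The squares separate the diagonals, as [(a + b) ^ 2 + a < (a + b).+1 ^ 2]. The pairing is
    injective but misses some numbers, such as 3. *)
Definition cpair a b := (a + b) ^ 2 + a.

Lemma cpair_inj a b a' b' : cpair a b = cpair a' b' -> a = a' /\ b = b'.
Proof.
have lt_sum c d c' d' : c + d < c' + d' -> cpair c d < cpair c' d'.
  move=> H; apply: (@leq_trans ((c + d).+1 ^ 2)); first by rewrite /cpair -!mulnn; nia.
  by rewrite (leq_trans _ (leq_addr _ _)) // leq_exp2r.
move=> H; have [/lt_sum|/lt_sum|E] := ltngtP (a + b) (a' + b'); rewrite ?H ?ltnn //.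
by move: H; rewrite /cpair E => /addnI H; lia.
Qed.

Lemma leq_cpairl a b : a <= cpair a b.
Proof. exact: leq_addl. Qed.

Lemma leq_cpairr a b : b <= cpair a b.
Proof. rewrite /cpair -mulnn; nia. Qed.

(** Written as an iteration so that [prim_iteri] applies. The default 0 is the value of [cfst] and
    [csnd] outside the range of [cpair]. *)
Definition the N (p : nat -> bool) := iteri N (fun k r => if p k then k else r) 0.

Lemma the_eq N (p : nat -> bool) k :
  k < N -> p k -> (forall j, p j -> j = k) -> the N p = k.
Proof.
move=> kN pk Hu; rewrite /the; elim: N kN => //= N IH.
rewrite ltnS leq_eqVlt => /orP[/eqP <-|/IH ->]; first by rewrite pk.
by case: ifP => // /Hu.
Qed.

Definition cfst x := the x.+1 (fun a => bex x.+1 (fun b => cpair a b == x)).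
Definition csnd x := the x.+1 (fun b => bex x.+1 (fun a => cpair a b == x)).
Arguments cfst : simpl never.
Arguments csnd : simpl never.

Lemma cfstK a b : cfst (cpair a b) = a.
Proof.
apply: the_eq; first by rewrite ltnS leq_cpairl.
  by apply/bexP; exists b => //; rewrite ltnS leq_cpairr.
by move=> j /bexP[k _ /eqP/cpair_inj[]].
Qed.

Lemma csndK a b : csnd (cpair a b) = b.
Proof.
apply: the_eq; first by rewrite ltnS leq_cpairr.
  by apply/bexP; exists a => //; rewrite ltnS leq_cpairl.
by move=> j /bexP[k _ /eqP/cpair_inj[]].
Qed.

Lemma prim_cpair n F G : prim n F -> prim n G -> prim n (fun v => cpair (F v) (G v)).
Proof.
by move=> HF HG; do ![apply: prim_add | apply: prim_exp | prim0].
Qed.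

Lemma prim_the n N (p : nat -> seq nat -> bool) :
  prim n N -> prim n.+2 (fun w => p (nth 0 w 0) (behead (behead w))) ->
  prim n (fun v => the (N v) (fun k => p k v)).
Proof.
move=> HN Hp; apply: (prim_iteri (H := fun k r v => if p k v then k else r)) => //.
  exact: prim_const.
by apply: prim_if => //; prim0.
Qed.

Lemma prim_cfst n F : prim n F -> prim n (fun v => cfst (F v)).
Proof.
apply: (prim_comp1 (f := cfst)).
apply: (prim_the (p := fun a v => bex (nth 0 v 0).+1 (fun b => cpair a b == nth 0 v 0))).
  by repeat prim0.
apply: (prim_bex (p := fun b w => cpair (nth 0 w 0) b == nth 0 (behead (behead w)) 0)).
  by repeat prim0.
by do ![apply: prim_eq | apply: prim_cpair | prim0].
Qed.

Lemma prim_csnd n F : prim n F -> prim n (fun v => csnd (F v)).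
Proof.
apply: (prim_comp1 (f := csnd)).
apply: (prim_the (p := fun b v => bex (nth 0 v 0).+1 (fun a => cpair a b == nth 0 v 0))).
  by repeat prim0.
apply: (prim_bex (p := fun a w => cpair a (nth 0 w 0) == nth 0 (behead (behead w)) 0)).
  by repeat prim0.
by do ![apply: prim_eq | apply: prim_cpair | prim0].
Qed.

(** * Bounded collection, and evaluation of programs through finite sets of runs *)

Lemma bounded_choice (Q : nat -> nat -> Prop) k :
  (forall j b b', b <= b' -> Q j b -> Q j b') ->
  (forall j, j < k -> exists b, Q j b) -> exists b, forall j, j < k -> Q j b.
Proof.
move=> mono; elim: k => [|k IH] H; first by exists 0.
have [|b Hb] := IH; first by move=> j jk; apply: H; apply: ltnW.
have [b' Hb'] := H k (ltnSn k).
(* Monotonicity allows the maximum; it also lets the lemma be nested over several bounded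
   quantifiers. *)
exists (maxn b b') => j; rewrite ltnS leq_eqVlt => /orP[/eqP ->|/Hb].
  by apply: mono Hb'; apply: leq_maxr.
by apply: mono; apply: leq_maxl.
Qed.

(* [rule D c u r]: the program coded by [c] outputs [r] on input [u], given
   that [D] describes the runs it depends on.  Programs compute unary
   functions; a tuple is coded by nested pairs ending in 0. *)
Definition rule (D : nat -> nat -> nat -> Prop) c u r : Prop :=
  let a := cfst (csnd c) in let b := csnd (csnd c) in
  match cfst c with
  | 0 => r = 0
  | 1 => r = u.+1
  | 2 => r = cfst u
  | 3 => r = csnd u
  | 4 => [/\ r = cpair (cfst r) (csnd r), D a u (cfst r) & D b u (csnd r)]
  | 5 => exists2 z, D b u z & D a z r
  | 6 => if cfst u is k.+1 then
           exists2 z, D c (cpair k (csnd u)) z & D b (cpair k (cpair z (csnd u))) r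
         else D a (csnd u) r
  | 7 => D a (cpair r u) 0 /\ forall z, z < r -> exists q, D a (cpair z u) q.+1
  | _ => False
  end.

(** [D] occurs only positively, even for minimization: a nonzero value is expressed by a run with a
    successor as output, not by the absence of a run. *)
Lemma rule_mono (D D' : nat -> nat -> nat -> Prop) c u r :
  (forall c u r, D c u r -> D' c u r) -> rule D c u r -> rule D' c u r.
Proof.
move=> DD; rewrite /rule.
case: (cfst c) => [|[|[|[|[|[|[|[|]]]]]]]] //.
- by move=> [? /DD ? /DD ?].
- by move=> [z /DD ? /DD ?]; exists z.
- by case: (cfst u) => [/DD //|k [z /DD ? /DD ?]]; exists z.
- by move=> [/DD ? H]; split=> // z /H[q /DD ?]; exists q.
Qed.

Definition run s c u r := bit s (cpair c (cpair u r)).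

Lemma run_lt s c u r : run s c u r -> u < s /\ r < s.
Proof.
move=> /bit_lt H; split; apply: leq_ltn_trans H.
  exact: leq_trans (leq_cpairl _ _) (leq_cpairr _ _).
exact: leq_trans (leq_cpairr _ _) (leq_cpairr _ _).
Qed.

(** A decidable form of [rule (run s)]: by [run_lt] the intermediate values are below [s], so the
    searches can be bounded. *)
Definition ruleb s c u r : bool :=
  let a := cfst (csnd c) in let b := csnd (csnd c) in
  [|| (cfst c == 0) && (r == 0),
      (cfst c == 1) && (r == u.+1),
      (cfst c == 2) && (r == cfst u),
      (cfst c == 3) && (r == csnd u),
      (cfst c == 4) &&
        [&& r == cpair (cfst r) (csnd r), run s a u (cfst r) & run s b u (csnd r)],
      (cfst c == 5) && bex s (fun z => run s b u z && run s a z r),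
      (cfst c == 6) &&
        ((cfst u == 0) && run s a (csnd u) r ||
         (0 < cfst u) && bex s (fun z => run s c (cpair (cfst u).-1 (csnd u)) z &&
           run s b (cpair (cfst u).-1 (cpair z (csnd u))) r)) |
      (cfst c == 7) &&
        (run s a (cpair r u) 0 &&
         ball r (fun z => bex s (fun q => run s a (cpair z u) q.+1)))].

Lemma rulebP s c u r : ruleb s c u r <-> rule (run s) c u r.
Proof.
rewrite /ruleb /rule.
case: (cfst c) => [|[|[|[|[|[|[|[|n]]]]]]]] //=; rewrite ?orbF.
- by split=> /eqP.
- by split=> /eqP.
- by split=> /eqP.
- by split=> /eqP.
- by split=> [/and3P[/eqP]|[<- -> ->]] //; rewrite eqxx.
- split=> [/bexP[z _ /andP[? ?]]|[z Hb Ha]]; first by exists z.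
  by apply/bexP; exists z; [have [] := run_lt Hb | rewrite Hb].
- case: (cfst u) => [|k] /=; first by rewrite orbF.
  split=> [/bexP[z _ /andP[? ?]]|[z Hb Ha]]; first by exists z.
  by apply/bexP; exists z; [have [] := run_lt Hb | rewrite Hb].
- split=> [/andP[-> /ballP H]|[-> H]].
    by split=> // z /H/bexP[q _]; exists q.
  apply/ballP => z /H[q Hq]; apply/bexP; exists q => //.
  by apply: ltnW; have [] := run_lt Hq.
Qed.

(* [s], read as a finite set of runs, is closed downwards under [rule], and
   therefore contains only correct runs. *)
Definition valid s : bool :=
  ball s (fun y => bit s y ==>
    ruleb s (cfst y) (cfst (csnd y)) (csnd (csnd y))).

Definition eval c u r : Prop := exists2 s, valid s & run s c u r.

Lemma validP s : valid s <->
  (forall y, bit s y -> rule (run s) (cfst y) (cfst (csnd y)) (csnd (csnd y))).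
Proof.
split=> [/ballP H y Hy|H].
  by apply/rulebP; have := H y (bit_lt Hy); rewrite Hy.
by apply/ballP => y _; apply/implyP => /H/rulebP.
Qed.

Lemma valid_union s s' : valid s -> valid s' ->
  exists2 t, valid t & forall y, bit s y || bit s' y -> bit t y.
Proof.
move=> /validP Hs /validP Hs'.
(* By [bit_lt], the bound [s + s'] exceeds every element of either set. *)
have [t _ Ht] := bit_exists (fun y => bit s y || bit s' y) (s + s').
have tE y : bit s y || bit s' y -> bit t y.
  move=> Hy; rewrite Ht Hy andbT.
  by case/orP: Hy => /bit_lt; lia.
exists t => //; apply/validP => y; rewrite Ht => /andP[_ /orP[/Hs|/Hs']].
  by apply: rule_mono => ? ? ? H; apply: tE; apply/orP; left.
by apply: rule_mono => ? ? ? H; apply: tE; apply/orP; right.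
Qed.

Lemma eval2 c u r c' u' r' : eval c u r -> eval c' u' r' ->
  exists t, [/\ valid t, run t c u r & run t c' u' r'].
Proof.
move=> [s Hs H] [s' Hs' H']; have [t Ht tE] := valid_union Hs Hs'.
by exists t; split=> //; apply: tE; apply/orP; [left | right].
Qed.

(** One application of a rule uses finitely many runs, and their certificates can be merged. *)
Lemma rule_eval_compact c u r : rule eval c u r ->
  exists2 s, valid s & rule (run s) c u r.
Proof.
rewrite /rule.
have V0 : valid 0 by [].
case: (cfst c) => [|[|[|[|[|[|[|[|]]]]]]]] //; try by exists 0.
- by move=> [? H1 H2]; have [t [? ? ?]] := eval2 H1 H2; exists t.
- move=> [z H1 H2]; have [t [? ? ?]] := eval2 H1 H2.
  by exists t => //; exists z.
- case: (cfst u) => [[s ? ?]|k]; first by exists s.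
  move=> [z H1 H2]; have [t [? ? ?]] := eval2 H1 H2.
  by exists t => //; exists z.
- move=> [H0 H]; set a := cfst _ in H0 H *.
  (* Minimization uses a number of runs that depends on [r]; those for [z < k] are gathered by
     induction on [k]. *)
  have /(_ r (leqnn r))[s Hs [s0 sr]] k : k <= r ->
      exists2 s, valid s & run s a (cpair r u) 0 /\
      forall z, z < k -> exists q, run s a (cpair z u) q.+1.
    elim: k => [|k IH] kr.
      by case: H0 => s ? ?; exists s => //; split.
    have [s Hs [s0 sk]] := IH (ltnW kr).
    have [q [s' Hs' Hq]] := H k kr.
    have [t Ht tE] := valid_union Hs Hs'.
    exists t => //; split=> [|z]; first by apply: tE; apply/orP; left.
    rewrite ltnS leq_eqVlt => /orP[/eqP ->|/sk[q' Hq']].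
      by exists q; apply: tE; apply/orP; right.
    by exists q'; apply: tE; apply/orP; left.
  by exists s.
Qed.

(** A valid set contains the premises of its runs. Conversely, a run whose premises lie in a valid
    set can be added to that set. *)
Lemma evalE c u r : eval c u r <-> rule eval c u r.
Proof.
split=> [[s Vs]|/rule_eval_compact[s /validP Hs Hr]].
  move: (Vs) => /validP Hs /Hs; rewrite !(cfstK, csndK).
  by apply: rule_mono => c' u' r' H; exists s.
set y := cpair c (cpair u r).
have [t _ Ht] := bit_exists (fun i => bit s i || (i == y)) (s + y.+1).
have tE i : bit s i -> bit t i.
  by move=> Hi; rewrite Ht Hi andbT; have := bit_lt Hi; lia.
exists t; last by rewrite /run Ht eqxx orbT andbT; lia.
have mono c' u' r' : rule (run s) c' u' r' -> rule (run t) c' u' r'.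
  by apply: rule_mono => ? ? ?; apply: tE.
apply/validP => i; rewrite Ht => /andP[_ /orP[/Hs/mono //|/eqP ->]].
by rewrite !(cfstK, csndK); apply: mono.
Qed.

Definition code t a b := cpair t (cpair a b).

Lemma eval_zero u r : eval (code 0 0 0) u r <-> r = 0.
Proof. by rewrite evalE /rule !(cfstK, csndK). Qed.

Lemma eval_succ u r : eval (code 1 0 0) u r <-> r = u.+1.
Proof. by rewrite evalE /rule !(cfstK, csndK). Qed.

Lemma eval_fst u r : eval (code 2 0 0) u r <-> r = cfst u.
Proof. by rewrite evalE /rule !(cfstK, csndK). Qed.

Lemma eval_snd u r : eval (code 3 0 0) u r <-> r = csnd u.
Proof. by rewrite evalE /rule !(cfstK, csndK). Qed.

Lemma eval_pair a b u r : eval (code 4 a b) u r <->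
  [/\ r = cpair (cfst r) (csnd r), eval a u (cfst r) & eval b u (csnd r)].
Proof. by rewrite evalE /rule !(cfstK, csndK). Qed.

Lemma eval_comp a b u r : eval (code 5 a b) u r <->
  exists2 z, eval b u z & eval a z r.
Proof. by rewrite evalE /rule !(cfstK, csndK). Qed.

Lemma eval_prec0 a b u r : eval (code 6 a b) (cpair 0 u) r <-> eval a u r.
Proof. by rewrite evalE /rule !(cfstK, csndK). Qed.

Lemma eval_precS a b k u r : eval (code 6 a b) (cpair k.+1 u) r <->
  exists2 z, eval (code 6 a b) (cpair k u) z & eval b (cpair k (cpair z u)) r.
Proof. by rewrite evalE /rule !(cfstK, csndK). Qed.

Lemma eval_mu a b u r : eval (code 7 a b) u r <->
  eval a (cpair r u) 0 /\ forall z, z < r -> exists q, eval a (cpair z u) q.+1.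
Proof. by rewrite evalE /rule !(cfstK, csndK). Qed.

(** * Every recursive function has a program *)

Definition enc (v : seq nat) := foldr cpair 0 v.

(** The equivalence gives termination and uniqueness of the output at once, so determinism is
    carried along the induction on recursive functions. *)
Definition computes n c (f : n.-tuple nat -> nat) :=
  forall (v : n.-tuple nat) r, eval c (enc v) r <-> r = f v.

Lemma computes_ex n (f : n.-tuple nat -> nat) : recursive f -> exists c, computes c f.
Proof.
elim=> {n f} [n||n i|n m f g _ [c Hc] _ Hg|n f g _ [a Ha] _ [b Hb]|n f h _ [a Ha] Hh].
- by exists (code 0 0 0) => v r; rewrite eval_zero.
- exists (code 5 (code 1 0 0) (code 2 0 0)) => v r; rewrite eval_comp.
  have E : cfst (enc v) = thead v by case/tupleP: v => x v; rewrite /= cfstK.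
  split=> [[z /eval_fst -> /eval_succ ->]|->]; first by rewrite E.
  by exists (thead v); [rewrite eval_fst E | rewrite eval_succ].
(* A tuple is a nested pair, so its [i]-th entry is reached by [i] second projections and one first
   projection. *)
- have [c Hc] : exists c, forall u r, eval c u r <-> r = cfst (iter i csnd u).
    elim: (val i) => [|k [c IH]]; first by exists (code 2 0 0) => u r; rewrite eval_fst.
    exists (code 5 c (code 3 0 0)) => u r; rewrite eval_comp iterSr.
    split=> [[z /eval_snd -> /IH //]|->]; exists (csnd u); first by rewrite eval_snd.
    by rewrite IH.
  exists c => v r; rewrite Hc (tnth_nth 0).
  suff -> : cfst (iter i csnd (enc v)) = nth 0 v i by [].
  have: i < size v by rewrite size_tuple.
  elim: (val i) (tval v) => [|k IH] [|x s] //=; first by rewrite cfstK.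
  by move=> Hk; rewrite -iterS iterSr csndK IH.
(* The programs for the [g i] are paired, one after the other, into a program for the coded tuple of
   their values. *)
- have [d Hd] : exists d, forall (v : n.-tuple nat) r,
      eval d (enc v) r <-> r = enc [seq g i v | i <- enum 'I_m].
    elim: (enum 'I_m) => [|i s [d IH]]; first by exists (code 0 0 0) => ? ?; rewrite eval_zero.
    have [e He] := Hg i; exists (code 4 e d) => v r; rewrite eval_pair /=.
    split=> [[Hr /He <- /IH <-] //|->].
    by split; rewrite ?cfstK ?csndK //; [apply/He | apply/IH].
  exists (code 5 c d) => v r; rewrite eval_comp.
  have E : [seq g i v | i <- enum 'I_m] = [tuple g i v | i < m] by [].
  split=> [[z /Hd -> ]|->]; first by rewrite E Hc.
  by exists (enc [tuple g i v | i < m]); [rewrite Hd | rewrite Hc].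
- exists (code 6 a b) => v; case/tupleP: v => k v.
  have -> : fprec f g [tuple of k :: v] =
      iteri k (fun k r => g [tuple of [:: k, r & v]]) (f v).
    rewrite /fprec /thead (tnth_nth 0) /=.
    congr iteri; last by congr f; apply: val_inj.
    by do 2![apply/funext => ?]; congr g; apply: val_inj.
  elim: k => [|k IH] r /=; first by rewrite eval_prec0 Ha.
  rewrite eval_precS; split=> [[z /IH -> ]|->].
    by move/(Hb [tuple of [:: _, _ & v]]).
  eexists; first by apply/IH.
  by apply/(Hb [tuple of [:: _, _ & v]]).
- exists (code 7 a 0) => v r; rewrite eval_mu; have [h0 hlt] := Hh v.
  have ev z q : eval a (cpair z (enc v)) q <-> q = f [tuple of z :: v].
    exact: (Ha [tuple of z :: v] q).
  split=> [[/ev r0 Hr]|->].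
    case: (ltngtP r (h v)) => // [/hlt Hz|/Hr[q /ev E]]; first by case: Hz.
    by have := etrans E h0.
  split=> [|z /hlt Hz]; first by apply/ev.
  by exists (f [tuple of z :: v]).-1; apply/ev; rewrite prednK // lt0n; apply/eqP.
Qed.

(** * Primitive recursive tests for runs, and an enumeration of the Sigma_2 sets *)

Ltac prim_step :=
  lazymatch goal with
  | H : prim ?n ?F |- prim ?n ?F => exact H
  | |- prim _ (fun v => nth 0 _ _) => prim_var
  | |- prim _ (fun v => nat_of_bool (~~ _)) => apply prim_negb
  | |- prim _ (fun v => nat_of_bool (_ && _)) => apply prim_andb
  | |- prim _ (fun v => nat_of_bool (_ || _)) => apply prim_orb
  | |- prim _ (fun v => nat_of_bool (_ ==> _)) => apply prim_implb
  | |- prim _ (fun v => nat_of_bool (_ <= _)) => apply prim_leq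
  | |- prim _ (fun v => nat_of_bool (_ == _)) => apply prim_eq
  | |- prim _ (fun v => nat_of_bool (bit _ _)) => apply prim_bit
  | |- prim _ (fun v => nat_of_bool (ball _ _)) => apply prim_ball
  | |- prim _ (fun v => nat_of_bool (bex _ _)) => apply prim_bex
  | |- prim _ (fun v => cpair _ _) => apply prim_cpair
  | |- prim _ (fun v => cfst _) => apply prim_cfst
  | |- prim _ (fun v => csnd _) => apply prim_csnd
  | |- prim _ (fun v => _ ^ _) => apply prim_exp
  | |- prim _ (fun v => _.-1) => apply prim_pred
  | |- prim _ (fun v => _.+1) => apply prim_succ
  | |- prim _ (fun v => ?c) => apply prim_const
  end.
Ltac prim := repeat prim_step.

Lemma prim_ruleb n S C U R : prim n S -> prim n C -> prim n U -> prim n R ->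
  prim n (fun v => ruleb (S v) (C v) (U v) (R v)).
Proof.
apply: (prim_comp4 (f := fun s c u r => ruleb s c u r : nat)).
rewrite /ruleb /run; prim.
Qed.

Lemma prim_valid n S : prim n S -> prim n (fun v => valid (S v)).
Proof.
apply: (prim_comp1 (f := fun s => valid s : nat)).
by rewrite /valid; prim; apply: prim_ruleb; prim.
Qed.

(* [excludes e x y t]: with [t = <z, s>], [s] certifies that the function with
   code [e] vanishes at [(z, y, x)]; if that function is the characteristic
   function of [S], then [t] refutes "for all z, S (z, y, x)". *)
Definition excludes e x y t : bool :=
  valid (csnd t) && run (csnd t) e (enc [:: cfst t; y; x]) 0.

Lemma prim_excludes n E X Y T : prim n E -> prim n X -> prim n Y -> prim n T ->
  prim n (fun v => excludes (E v) (X v) (Y v) (T v)).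
Proof.
move=> HE HX HY HT; rewrite /excludes /run /enc /=.
by apply: prim_andb; [apply: prim_valid|]; prim.
Qed.

Lemma excludes_ex e x y :
  (exists t, excludes e x y t) <-> exists z, eval e (enc [:: z; y; x]) 0.
Proof.
split=> [[t /andP[Hv Hr]]|[z [s Hv Hr]]]; first by exists (cfst t), (csnd t).
by exists (cpair z s); rewrite /excludes !(cfstK, csndK) Hv.
Qed.

(** The [e]-th Sigma_2 set; this makes sense even if [e] codes no characteristic function. *)
Definition member e x := exists y, forall t, ~~ excludes e x y t.

(** Take for [e] a program for the characteristic function of the recursive matrix: the inner
    universal quantifier fails exactly if some [t] certifies the value 0. *)
Lemma Sigma2_member (C : set nat) : Sigma_set 2 C ->
  exists e, forall x, C x <-> member e x.
Proof.
move=> [S1 [S2 HS2 ES1] EC]; have [e He] := computes_ex HS2; exists e => x.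
have -> : C x <-> unary C [tuple x] by [].
have evS z y : eval e (enc [:: z; y; x]) 0 <->
    ~ S2 [tuple of z :: [tuple of y :: [tuple x]]].
  rewrite (He [tuple of z :: [tuple of y :: [tuple x]]]) /charfun.
  split=> [/esym/eqP|nS]; first by rewrite eqb0 => /negP nS /mem_set.
  by apply/esym/eqP; rewrite eqb0; apply/negP => /set_mem.
rewrite EC ES1 /=; split=> -[y] Hy; exists y.
  move=> t; apply/negP => Ht.
  have /excludes_ex[z /evS] : exists t, excludes e x y t by exists t.
  by case.
move=> z; apply: contrapT => /evS Hz.
have [t] : exists t, excludes e x y t by apply/excludes_ex; exists z.
exact/negP.
Qed.

(** * The Pi_1 set *)

Definition len x := cfst x.
Definition str x := cfst (csnd x).
Definition wit x := cfst (csnd (csnd x)).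
Definition stage x := csnd (csnd (csnd x)).
Definition node n rho w s := cpair n (cpair rho (cpair w s)).

Lemma nodeK n rho w s : [/\ len (node n rho w s) = n, str (node n rho w s) = rho,
  wit (node n rho w s) = w & stage (node n rho w s) = s].
Proof. by rewrite /len /str /wit /stage !(cfstK, csndK). Qed.

Definition color x e := bit (str x) e.

(* The admissibility of [rho] up to [n], with witnesses below [w], as it looks
   at stage [s]: that [y] proves [member e x] is only tested for [t < s]. *)
Definition approx s n rho w : bool :=
  ball n (fun e => ball n (fun x0 => ball n (fun y0 =>
    bex w (fun t => excludes e x0 y0 t) ||
    bex w (fun x => bex w (fun y =>
      [&& x0 <= x, ~~ (color x e == bit rho e) &
          ball s (fun t => ~~ excludes e x y t)]))))).

Lemma prim_eqb n (b c : seq nat -> bool) :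
  prim n (fun v => b v) -> prim n (fun v => c v) -> prim n (fun v => b v == c v).
Proof.
move=> Hb Hc; apply: (@eq_prim _ (fun v => (b v : nat) == c v)).
  by move=> v _; case: (b v); case: (c v).
exact: prim_eq.
Qed.

Lemma prim_approx n S N R W : prim n S -> prim n N -> prim n R -> prim n W ->
  prim n (fun v => approx (S v) (N v) (R v) (W v)).
Proof.
apply: (prim_comp4 (f := fun s n r w => approx s n r w : nat)).
rewrite /approx /color /str.
prim.
all: first [apply: prim_excludes; prim | apply: prim_eqb; prim].
Qed.

(** The first conjunct discards numbers that are not codes of nodes, and the bound on [rho] leaves
    finitely many strings of each length. The bound 0 has no predecessor to refute, so its stage is
    set to 0. Only the third conjunct depends on [s]. *)
Definition good_stage x s : bool :=
  let n := len x in let rho := str x in let w := wit x in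
  [&& x == node n rho w (stage x), rho < 2 ^ n, approx s n rho w &
    ((w == 0) && (stage x == 0)) ||
    [&& 0 < w, ~~ approx (stage x) n rho w.-1 &
        ball (stage x) (fun j => approx j n rho w.-1)]].

Lemma prim_good_stage n X S : prim n X -> prim n S ->
  prim n (fun v => good_stage (X v) (S v)).
Proof.
apply: (prim_comp2 (f := fun x s => good_stage x s : nat)).
rewrite /good_stage /len /str /wit /stage /node.
prim; apply: prim_approx; prim.
Qed.

Definition branches : set nat := [set x | forall s, good_stage x s].

Lemma Pi1_branches : Pi_set 1 branches.
Proof.
exists [set v : 2.-tuple nat | good_stage (tnth v ord_max) (tnth v ord0)].
  apply: primitive_recursive_recursive.
  have : prim 2 (fun v => good_stage (nth 0 v 1) (nth 0 v 0)).
    by apply: prim_good_stage; prim.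
  congr (primitive_recursive _); apply/funext => v; rewrite /charfun; congr nat_of_bool.
  rewrite -(tnth_nth 0 v ord0) -(tnth_nth 0 v ord_max).
  by apply/idP/idP => [/mem_set|/set_mem].
apply/seteqP; split=> v /= H s.
  by have := H s; rewrite /thead !(tnth_nth 0).
by have := H s; rewrite /thead !(tnth_nth 0).
Qed.

(** * Uniqueness and existence of nodes *)

Lemma approx_leq s n rho w w' : w <= w' -> approx s n rho w -> approx s n rho w'.
Proof.
move=> ww' H; apply/ballP => e en; apply/ballP => x0 xn; apply/ballP => y0 yn.
move/ballP/(_ e en)/ballP/(_ x0 xn)/ballP/(_ y0 yn): H.
case/orP=> [/bexP[t tw Ht]|/bexP[x xw /bexP[y yw Hxy]]]; apply/orP.
  by left; apply/bexP; exists t => //; apply: leq_trans ww'.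
right; apply/bexP; exists x; first exact: leq_trans ww'.
by apply/bexP; exists y => //; apply: leq_trans ww'.
Qed.

(** If [wit y < wit y'], the bound [wit y] holds at every stage, hence by monotonicity so does
    [(wit y').-1], against its refutation at [stage y']. With equal bounds, the smaller stage would
    refute what still holds at all stages before the larger one. *)
Lemma branches_inj x x' : branches x -> branches x' ->
  len x = len x' -> str x = str x' -> x = x'.
Proof.
have lt_wit y y' : branches y -> branches y' -> len y = len y' -> str y = str y' ->
    ~ wit y < wit y'.
  move=> By By' En Er lt.
  have /and4P[_ _ _ /orP[/andP[/eqP w0]|/and3P[_ /negP Hn _]]] := By' 0.
    by rewrite w0 in lt.
  apply: Hn; have /and4P[_ _ Ha _] := By (stage y'); rewrite -En -Er.
  by apply: approx_leq Ha; lia.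
have lt_stage y y' : branches y -> branches y' -> len y = len y' -> str y = str y' ->
    wit y = wit y' -> ~ stage y < stage y'.
  move=> By By' En Er Ew lt.
  have /and4P[_ _ _ /orP[/andP[_ /eqP s0]|/and3P[_ _ /ballP/(_ _ lt)]]] := By' 0.
    by rewrite s0 in lt.
  rewrite -En -Er -Ew => Ha.
  (* There remains the case [wit y = 0], but the positive stage of [y'] forces [wit y'] to be
     positive. *)
  have /and4P[_ _ _ /orP[/andP[/eqP w0 _]|/and3P[_ /negP]]] // := By 0.
  have /and4P[_ _ _ /orP[/andP[_ /eqP s0]|/and3P[w'_gt0 _ _]]] := By' 0.
    by rewrite s0 in lt.
  by rewrite -Ew w0 in w'_gt0.
move=> Bx Bx' En Er.
have Ew : wit x = wit x'.
  by case: (ltngtP (wit x) (wit x')) => // /lt_wit [].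
have Es : stage x = stage x'.
  by case: (ltngtP (stage x) (stage x')) => // /lt_stage [].
have /and4P[/eqP -> _ _ _] := Bx 0; have /and4P[/eqP -> _ _ _] := Bx' 0.
by rewrite En Er Ew Es.
Qed.

(** Admissibility of [i] at [e], with [member e x0] unfolded so that each instance [(x0, y0)] asks
    only for finitely many witnesses, which [approx] bounds by [w]. *)
Definition avoids e (i : bool) := forall x0 y0,
  (exists t, excludes e x0 y0 t) \/
  exists x y, [/\ x0 <= x, color x e != i & forall t, ~~ excludes e x y t].

Lemma avoids_ex e : exists i, avoids e i.
Proof.
have not_avoids i : ~ avoids e i ->
    exists2 x0, member e x0 & forall x, member e x -> x0 <= x -> color x e = i.
  move=> Hi; apply: contrapT => H; apply: Hi => x0 y0.
  apply: contrapT => /not_orP[H1 H2]; apply: H; exists x0.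
    by exists y0 => t; apply/negP => Ht; apply: H1; exists t.
  move=> x [y Hy] x0x; apply/eqP; apply: contrapT => /negP Hc.
  by apply: H2; exists x, y.
apply: contrapT => H.
have [x0 m0 H0] := not_avoids true (fun Ht => H (ex_intro _ true Ht)).
have [x1 m1 H1] := not_avoids false (fun Hf => H (ex_intro _ false Hf)).
have [le01|/ltnW le10] := leqP x0 x1.
  by have := H0 _ m1 le01; rewrite H1.
by have := H1 _ m0 le10; rewrite H0.
Qed.

Lemma least (Q : nat -> Prop) : (exists n, Q n) ->
  exists2 n, Q n & forall m, m < n -> ~ Q m.
Proof.
move=> [n0 Hn0]; have Hex : exists n, `[< Q n >] by exists n0; apply/asboolP.
case: (ex_minnP Hex) => n /asboolP Hn Hmin; exists n => // m mn /asboolP /Hmin.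
by rewrite leqNgt mn.
Qed.

(** A string of admissible colors satisfies its finitely many instances below [n] with a common
    bound; the node records the least bound and the first stage refuting its predecessor. *)
Lemma branches_len n : exists2 x, branches x & len x = n.
Proof.
have [X HX] := choice avoids_ex.
have [rho rho_lt Hrho] := bit_exists X n.
(* An instance of [approx] in which [y] must survive every [t], not just those below a stage. *)
pose Q e x0 y0 w := (exists2 t, t < w & excludes e x0 y0 t) \/
  exists x y, [/\ x < w, y < w, x0 <= x, color x e != X e &
    forall t, ~~ excludes e x y t].
have Qmono e x0 y0 w w' : w <= w' -> Q e x0 y0 w -> Q e x0 y0 w'.
  move=> ww' [[t tw Ht]|[x [y [xw yw ? ? ?]]]].
    by left; exists t => //; apply: leq_trans ww'.
  by right; exists x, y; split=> //; [apply: leq_trans ww' | apply: leq_trans yw ww'].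
have [w0 Hw0] : exists w, forall e, e < n -> forall x0, x0 < n ->
    forall y0, y0 < n -> Q e x0 y0 w.
  apply: bounded_choice => [e w w' ww' H x0 Hx y0 Hy|e _].
    exact: Qmono ww' (H _ Hx _ Hy).
  apply: bounded_choice => [x0 w w' ww' H y0 Hy|x0 _]; first exact: Qmono ww' (H _ Hy).
  apply: bounded_choice => [y0 w w' ww'|y0 _]; first exact: Qmono.
  have [[t Ht]|[x [y [? ? ?]]]] := HX e x0 y0; first by exists t.+1; left; exists t.
  by exists (maxn x y).+1; right; exists x, y; split; rewrite ?ltnS ?leq_maxl ?leq_maxr.
have Hex : exists w, forall s, approx s n rho w.
  exists w0 => s; apply/ballP => e en; apply/ballP => x0 xn; apply/ballP => y0 yn.
  apply/orP; have [[t tw Ht]|[x [y [xw yw x0x Hc Hxy]]]] := Hw0 e en x0 xn y0 yn.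
    by left; apply/bexP; exists t.
  right; apply/bexP; exists x => //; apply/bexP; exists y => //.
  by rewrite x0x Hrho en Hc /=; apply/ballP => t _.
have [w Hw wmin] := least Hex.
case: w => [|w] in Hw wmin.
  exists (node n rho 0 0); last by have [] := nodeK n rho 0 0.
  move=> s; rewrite /good_stage; have [-> -> -> ->] := nodeK n rho 0 0.
  by rewrite eqxx rho_lt Hw.
(* Since [w.+1] is the least bound, [w] fails at some stage. *)
have [s Hs smin] : exists2 s, ~ approx s n rho w &
    forall j, j < s -> ~ ~ approx j n rho w.
  apply: least; apply: contrapT => H; apply: (wmin w) => // s.
  by apply: contrapT => Hs; apply: H; exists s.
exists (node n rho w.+1 s); last by have [] := nodeK n rho w.+1 s.
move=> j; rewrite /good_stage; have [-> -> -> ->] := nodeK n rho w.+1 s.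
rewrite eqxx rho_lt Hw /=; apply/andP; split; first exact/negP.
by apply/ballP => k /smin /contrapT.
Qed.

(** * Infinite subsets of the Pi_1 set *)

Lemma finite_set_bounded (A : set nat) :
  finite_set A <-> exists b, forall x, A x -> x < b.
Proof.
split=> [/finite_seqP[s ->]|[b Hb]].
  exists (\max_(x <- s) x).+1 => x /= xs.
  by rewrite ltnS; apply: leq_bigmax_seq.
by apply: (sub_finite_set (B := `I_b)) => // ; apply: finite_II.
Qed.

Lemma infinite_branches : infinite_set branches.
Proof.
move=> /(finite_image len); suff -> : len @` branches = setT by exact: infinite_nat.
by apply/seteqP; split=> // n _; have [x Bx <-] := branches_len n; exists x.
Qed.

(** Lengths up to [N] and strings below [2 ^ N] form finitely many pairs, and by [branches_inj] each
    pair belongs to at most one node. *)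
Lemma len_unbounded (C : set nat) N : C `<=` branches -> infinite_set C ->
  exists2 x, C x & N < len x.
Proof.
move=> CB Cinf; apply: contrapT => H; apply: Cinf; apply/finite_set_bounded.
have lenN x : C x -> len x <= N.
  by move=> Cx; rewrite leqNgt; apply/negP => Hx; apply: H; exists x.
have [b Hb] : exists b, forall n, n < N.+1 -> forall rho, rho < 2 ^ N ->
    forall x, C x -> len x = n -> str x = rho -> x < b.
  apply: bounded_choice => [n b b' bb' Hb r Hr x Cx En Er|n _].
    by apply: leq_trans bb'; apply: Hb Er.
  apply: bounded_choice => [r b b' bb' Hb x Cx En Er|r _].
    by apply: leq_trans bb'; apply: Hb.
  have [[y [Cy En Er]]|Hno] := pselect (exists x, [/\ C x, len x = n & str x = r]).
    exists y.+1 => x Cx Ex Rx; rewrite ltnS; suff -> : x = y by [].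
    by apply: branches_inj; [apply: CB | apply: CB | rewrite Ex | rewrite Rx].
  by exists 0 => x Cx Ex Rx; case: Hno; exists x.
exists b => x Cx; apply: (Hb (len x) _ (str x)) => //; first by rewrite ltnS lenN.
have /and4P[_ Hr _ _] := CB x Cx 0.
by apply: leq_trans Hr _; rewrite leq_exp2l // lenN.
Qed.

(** * Limit colors of p-cohesive subsets *)

Lemma primitive_recursive_color e : primitive_recursive_set [set x | color x e].
Proof.
have : prim 1 (fun v => color (nth 0 v 0) e) by rewrite /color /str; prim.
congr (primitive_recursive _); apply/funext => v; rewrite /charfun; congr nat_of_bool.
rewrite /unary /thead -(tnth_nth 0 v ord0).
by apply/idP/idP => [/mem_set|/set_mem].
Qed.

Theorem corollary3p6 :
  exists P : set nat,
    [/\ infinite_set P, Pi_set 1 P &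
        forall C : set nat, C `<=` P -> Delta_set 2 C -> ~ p_cohesive C].
Proof.
exists branches; split; [exact: infinite_branches | exact: Pi1_branches |].
move=> C CB [/Sigma2_member[e He] _] [Cinf Ccoh].
(* Here [i] is the limit color at [e]: all elements of [C] from [N] on have it. *)
have [i [N HN]] : exists i, exists N, forall x, C x -> color x e != i -> x < N.
  have [/finite_set_bounded[N HN]|/finite_set_bounded[N HN]] :=
    Ccoh _ (primitive_recursive_color e).
    by exists true, N => x Cx Hc; apply: HN; split=> //= Hx; rewrite Hx in Hc.
  by exists false, N => x Cx; rewrite eqbF_neg negbK => Hc; apply: HN; split=> // /(_ Hc).
have [x0 Cx0 Nx0] : exists2 x, C x & N <= x.
  apply: contrapT => H; apply: Cinf; apply/finite_set_bounded; exists N => x Cx.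
  by rewrite ltnNge; apply/negP => Hx; apply: H; exists x.
have /He[y0 Hy0] := Cx0.
(* The length of [z] puts the instance [(e, x0, y0)] among those that [z] satisfies, and puts [z]
   itself beyond [N]. *)
have [z Cz] := len_unbounded (maxn e (maxn (maxn x0 y0) N)) CB Cinf.
rewrite !gtn_max => /and3P[ez /andP[xz yz] Nz].
have len_z : len z <= z.
  by have /and4P[/eqP zE _ _ _] := CB _ Cz 0; rewrite [leqRHS]zE leq_cpairl.
have Hz : color z e = i.
  apply/eqP; apply: contrapT => /negP /(HN _ Cz).
  by rewrite ltnNge (leq_trans (ltnW Nz)).
pose w := wit z.
(* A number [x >= x0] of the other color is not in [C], so each [y] is refuted as a proof of
   [member e x]. One stage [s] covers the finitely many pairs below [w]. *)
pose Q x y b := x0 <= x -> color x e != i -> exists2 t, t < b & excludes e x y t.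
have [s Hs] : exists b, forall x, x < w -> forall y, y < w -> Q x y b.
  apply: bounded_choice => [x b b' bb' H y yw x0x Hc|x _].
    by have [t tb ?] := H y yw x0x Hc; exists t => //; apply: leq_trans bb'.
  apply: bounded_choice => [y b b' bb' H x0x Hc|y _].
    by have [t tb ?] := H x0x Hc; exists t => //; apply: leq_trans bb'.
  have [[t Ht]|H] := pselect (exists t, excludes e x y t).
    by exists t.+1 => _ _; exists t.
  exists 0 => x0x Hc.
  have Cx : C x by apply/He; exists y => t; apply/negP => Ht; apply: H; exists t.
  by have := HN _ Cx Hc; rewrite ltnNge (leq_trans Nx0).
(* At stage [s], the first alternative contradicts the choice of [y0], and the second gives [x] and
   [y] below [w] that are not refuted before [s]. *)
have /and4P[_ _ /ballP/(_ e ez)/ballP/(_ x0 xz)/ballP/(_ y0 yz) Ha _] := CB _ Cz s.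
case/orP: Ha => [/bexP[t _]|/bexP[x xw /bexP[y yw /and3P[x0x Hc /ballP Hxy]]]].
  exact/negP.
have [|t /Hxy /negP] := Hs x xw y yw x0x; last by [].
by move: Hc; rewrite -[bit _ _]/(color z e) Hz.
Qed.
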